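(* Let $A\in\mathbb{R}^{n\times n}$ be a nonsingular matrix and let $y\in\mathbb{R}^n$. For $\lambda\in(0,\infty)$ define $$\mathbf{A}_\lambda=\begin{bmatrix} I & 0\\ \sqrt{\lambda}\,A & -\sqrt{\lambda}\,y\end{bmatrix}\in\mathbb{R}^{2n\times(n+1)},$$ where $I$ is the $n\times n$ identity matrix and $0$ is the zero column vector in $\mathbb{R}^n$. Then the condition number of $\mathbf{A}_\lambda$ satisfies $$\liminf_{\lambda\to\infty}\kappa(\mathbf{A}_\lambda)\;\ge\;\kappa(A)^2,$$ and therefore the condition number of the unconstrained optimization problem from the penalty method (the least-squares problem with coefficient matrix $\mathbf{A}_\lambda$) is asymptotically, as $\lambda\to\infty$, the square of that from physics constrained learning (PCL).
   Context: $\kappa(M)$ denotes the condition number of a matrix $M$ (ratio of largest to smallest singular value). The model problem is $\min_{\theta\in\mathbb{R}}\|u-u_0\|_2^2$ subject to $Au=\theta y$, where $\theta$ is an unknown scalar whose true value is $1$, and $u_0=A^{-1}y$. Penalty method: the constraint is added to the loss with a multiplier $\lambda$, and one solves the unconstrained problem $\min_{\theta,u}\|u-u_0\|_2^2+\lambda\|Au-\theta y\|_2^2$, in which both $u$ and $\theta$ are optimization variables. This is the least-squares problem of minimizing $\left\|\mathbf{A}_\lambda\begin{bmatrix}u\\ \theta\end{bmatrix}-\begin{bmatrix}u_0\\ 0\end{bmatrix}\right\|_2^2$ over $(u,\theta)\in\mathbb{R}^n\times\mathbb{R}$. Physics constrained learning (PCL): the constraint is solved exactly for $u$, and only $\theta$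 is optimized. The loss is $\|\theta A^{-1}y-u_0\|_2^2=(\theta-1)^2\|u_0\|_2^2$. Evaluating it requires solving the linear system $Au=y$, whose computational cost usually depends on the condition number $\kappa(A)$. The condition number attributed to PCL in the comparison is $\kappa(A)$.
   Formalization: The closing claim that the penalty method's condition number ''is asymptotically the square'' of that of PCL is read as ''asymptotically at least the square''; literal equality is false, since the condition number of A_λ tends to infinity for every nonsingular A. Also n ≥ 1 is assumed. *)

(* Defs.v *)
From HB Require Import structures.
From mathcomp Require Import all_boot all_order all_algebra.
From mathcomp Require Import all_classical all_reals all_analysis.

Set Implicit Arguments.
Unset Strict Implicit.
Unset Printing Implicit Defensive.

Import Order.TTheory GRing.Theory Num.Theory.
Import numFieldNormedType.Exports.

Local Open Scope classical_set_scope.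
Local Open Scope ring_scope.

Definition sqnorm2 (R : realType) (m : nat) (v : 'cV[R]_m) : R :=
  \sum_(i < m) v i 0 ^+ 2.

(* An m x p matrix has min(m, p) singular values, counted with multiplicity:
   the square roots of the eigenvalues of the smaller of its two Gram
   matrices.  Using the larger one would add spurious zeros. *)
Definition singular_values (R : realType) (m p : nat) (M : 'M[R]_(m, p)) :
    set R :=
  [set s | 0 <= s /\
    (if (p <= m)%N then eigenvalue (M^T *m M) (s ^+ 2)
     else eigenvalue (M *m M^T) (s ^+ 2))].

(* For nonempty matrices the set of singular values is finite and nonempty, so
   this supremum and this infimum are a maximum and a minimum. *)
Definition max_singular_value (R : realType) (m p : nat) (M : 'M[R]_(m, p)) :
    R := sup (singular_values M).

Definition min_singular_value (R : realType) (m p : nat) (M : 'M[R]_(m, p)) :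
    R := inf (singular_values M).

(* Extended-real valued: a rank-deficient matrix has condition number +oo
   (the quotient x / 0 in R would be 0). *)
Definition condition_number (R : realType) (m p : nat) (M : 'M[R]_(m, p)) :
    \bar R :=
  if min_singular_value M == 0 then +oo%E
  else (max_singular_value M / min_singular_value M)%:E.

(* The problem of minimizing the squared 2-norm of M x - b over x. *)
Record lsq_problem (R : realType) (m p : nat) := LsqProblem {
  lsq_coef : 'M[R]_(m, p);
  lsq_rhs : 'cV[R]_m }.

Definition lsq_loss (R : realType) (m p : nat) (P : lsq_problem R m p)
    (x : 'cV[R]_p) : R :=
  sqnorm2 (lsq_coef P *m x - lsq_rhs P).

Definition lsq_condition_number (R : realType) (m p : nat)
    (P : lsq_problem R m p) : \bar R :=
  condition_number (lsq_coef P).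

Definition penalty_loss (R : realType) (n : nat) (A : 'M[R]_n) (y : 'cV[R]_n)
    (lambda : R) (u : 'cV[R]_n) (theta : R) : R :=
  sqnorm2 (u - invmx A *m y) + lambda * sqnorm2 (A *m u - theta *: y).

Definition penalty_mx (R : realType) (n : nat) (A : 'M[R]_n) (y : 'cV[R]_n)
    (lambda : R) : 'M[R]_(n + n, n + 1) :=
  block_mx 1%:M 0
           (Num.sqrt lambda *: A) (- (Num.sqrt lambda *: y)).

Definition penalty_problem (R : realType) (n : nat) (A : 'M[R]_n)
    (y : 'cV[R]_n) (lambda : R) : lsq_problem R (n + n) (n + 1) :=
  LsqProblem (penalty_mx A y lambda) (col_mx (invmx A *m y) 0).

(* Physics constrained learning eliminates u by solving the linear system
   A u = y; its condition number is that of this system. *)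
Definition pcl_condition_number (R : realType) (n : nat) (A : 'M[R]_n) :
    \bar R :=
  condition_number A.

(* Main.v *)
(* Rayleigh quotients bound the extreme singular values.  The vector (e_1, 0)
   gives sigma_max(A_lambda)^2 >= lambda |A e_1|^2, and (A^-1 y, 1), which
   satisfies the constraint exactly, gives sigma_min(A_lambda) <= 1.  Hence
   kappa(A_lambda) >= sqrt(lambda) |A e_1| tends to infinity, and in particular
   it eventually exceeds any multiple of kappa(A)^2. *)
Require Import Defs.
From HB Require Import structures.
From mathcomp Require Import all_boot all_order all_algebra.
From mathcomp Require Import all_classical all_reals all_analysis.
From mathcomp Require Import ring lra.

Set Implicit Arguments.
Unset Strict Implicit.
Unset Printing Implicit Defensive.

Import Order.TTheory GRing.Theory Num.Theory.
Import numFieldNormedType.Exports.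

Local Open Scope classical_set_scope.
Local Open Scope ring_scope.

(** * Bilinear forms and squared norms *)

Definition bform (R : realType) (n : nat) (B : 'M[R]_n) (x y : 'cV[R]_n) : R :=
  (x^T *m B *m y) 0 0.

Lemma bformDl (R : realType) (n : nat) (B : 'M[R]_n) (x y z : 'cV[R]_n) :
  bform B (x + y) z = bform B x z + bform B y z.
Proof. by rewrite /bform linearD /= !mulmxDl mxE. Qed.

Lemma bformDr (R : realType) (n : nat) (B : 'M[R]_n) (x y z : 'cV[R]_n) :
  bform B x (y + z) = bform B x y + bform B x z.
Proof. by rewrite /bform mulmxDr mxE. Qed.

Lemma bformZl (R : realType) (n : nat) (B : 'M[R]_n) (a : R) (x y : 'cV[R]_n) :
  bform B (a *: x) y = a * bform B x y.
Proof. by rewrite /bform linearZ /= -!scalemxAl mxE. Qed.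

Lemma bformZr (R : realType) (n : nat) (B : 'M[R]_n) (a : R) (x y : 'cV[R]_n) :
  bform B x (a *: y) = a * bform B x y.
Proof. by rewrite /bform -scalemxAr mxE. Qed.

Lemma bformC (R : realType) (n : nat) (B : 'M[R]_n) (x y : 'cV[R]_n) :
  B^T = B -> bform B y x = bform B x y.
Proof.
move=> symB; rewrite /bform -[in RHS](trmxK (x^T *m B *m y)) [in RHS]mxE.
by rewrite !trmx_mul trmxK symB mulmxA.
Qed.

Lemma sqnorm2E (R : realType) (n : nat) (x : 'cV[R]_n) :
  sqnorm2 x = bform 1%:M x x.
Proof.
by rewrite /bform mulmx1 mxE; apply: eq_bigr => i _; rewrite mxE expr2.
Qed.

Lemma sqnorm2_mul (R : realType) (m n : nat) (M : 'M[R]_(m, n)) (x : 'cV[R]_n) :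
  sqnorm2 (M *m x) = bform (M^T *m M) x x.
Proof. by rewrite sqnorm2E /bform mulmx1 trmx_mul !mulmxA. Qed.

Lemma sqnorm2_ge0 (R : realType) (n : nat) (x : 'cV[R]_n) : 0 <= sqnorm2 x.
Proof. by apply: sumr_ge0 => i _; exact: sqr_ge0. Qed.

Lemma sqnorm20 (R : realType) (n : nat) : sqnorm2 (0 : 'cV[R]_n) = 0.
Proof. by rewrite /sqnorm2 big1// => i _; rewrite mxE expr0n. Qed.

Lemma sqnorm2_delta (R : realType) (n : nat) (i : 'I_n) :
  sqnorm2 (delta_mx i 0 : 'cV[R]_n) = 1.
Proof.
rewrite /sqnorm2 (bigD1 i)//= big1 ?mxE ?eqxx ?expr1n ?addr0// => j /negPf.
by rewrite mxE => -> /=; rewrite expr0n.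
Qed.

Lemma sqnorm2_eq0 (R : realType) (n : nat) (x : 'cV[R]_n) :
  (sqnorm2 x == 0) = (x == 0).
Proof.
apply/eqP/eqP => [/eqP|->].
  rewrite psumr_eq0 => [/allP x0|i _]; last exact: sqr_ge0.
  apply/colP => i; rewrite mxE; apply/eqP.
  by have := x0 i (mem_index_enum _); rewrite sqrf_eq0.
exact: sqnorm20.
Qed.

Lemma sqnorm2Z (R : realType) (n : nat) (a : R) (x : 'cV[R]_n) :
  sqnorm2 (a *: x) = a ^+ 2 * sqnorm2 x.
Proof. by rewrite !sqnorm2E bformZl bformZr mulrA -expr2. Qed.

Lemma sqnorm2_col_mx (R : realType) (m n : nat) (x : 'cV[R]_m) (y : 'cV[R]_n) :
  sqnorm2 (col_mx x y) = sqnorm2 x + sqnorm2 y.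
Proof.
rewrite /sqnorm2 big_split_ord /=; congr +%R.
  by apply: eq_bigr => i _; rewrite col_mxEu.
by apply: eq_bigr => i _; rewrite col_mxEd.
Qed.

Lemma bform_subZ (R : realType) (n : nat) (S : 'M[R]_n) (a : R) (x : 'cV[R]_n) :
  bform (S - a%:M) x x = bform S x x - a * sqnorm2 x.
Proof.
rewrite sqnorm2E /bform -[a%:M]scalemx1 mulmxBr mulmxBl -scalemxAr -scalemxAl mxE.
by congr (_ + _); rewrite mxE; congr (- _); rewrite mxE.
Qed.

(** * Cauchy-Schwarz and upper bounds for quadratic forms *)

Lemma cauchy_schwarz_bform (R : realType) (n : nat) (B : 'M[R]_n)
    (x y : 'cV[R]_n) : B^T = B -> (forall z, 0 <= bform B z z) ->
  bform B x y ^+ 2 <= bform B x x * bform B y y.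
Proof.
move=> symB psdB.
set a := bform B x x; set b := bform B x y; set c := bform B y y.
have qE s t : bform B (s *: x + t *: y) (s *: x + t *: y) =
    s ^+ 2 * a + 2 * s * t * b + t ^+ 2 * c.
  rewrite !(bformDl, bformDr, bformZl, bformZr) (bformC x y symB) -/a -/b -/c.
  by ring.
have c0 : 0 <= c := psdB y.
have [c_eq0|c_neq0] := eqVneq c 0.
  suff -> : b = 0 by rewrite c_eq0 mulr0 expr2 mulr0.
  apply/eqP/negPn/negP => b0.
  (* [B] is only semidefinite, so [c = 0] does not force [y = 0]. With [b] nonzero the form is
     affine in the coefficient of [y], and this coefficient gives it the value [-1]. *)
  have := psdB (1 *: x + (- (a + 1) / (2 * b)) *: y); rewrite qE c_eq0.
  suff -> : 1 ^+ 2 * a + 2 * 1 * (- (a + 1) / (2 * b)) * b +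
      (- (a + 1) / (2 * b)) ^+ 2 * 0 = -1 by rewrite oppr_ge0 ler10.
  by field.
have c_gt0 : 0 < c by rewrite lt_def c_neq0.
(* This vector is [c] times the part of [x] that is [B]-orthogonal to [y]. *)
have := psdB (c *: x + (- b) *: y); rewrite qE.
have -> : c ^+ 2 * a + 2 * c * - b * b + (- b) ^+ 2 * c =
    c * (a * c - b ^+ 2) by ring.
by rewrite pmulr_rge0// subr_ge0.
Qed.

(** Cauchy-Schwarz on each row gives the squared Frobenius norm as a constant; adding 1 makes it
    positive even when [M = 0]. *)
Lemma sqnorm2_mulmx_bounded (R : realType) (m n : nat) (M : 'M[R]_(m, n)) :
  exists2 K : R, 0 < K & forall x, sqnorm2 (M *m x) <= K * sqnorm2 x.
Proof.
exists (1 + \sum_i \sum_j M i j ^+ 2) => [|x].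
  rewrite ltr_pwDl//; apply: sumr_ge0 => i _; apply: sumr_ge0 => j _.
  exact: sqr_ge0.
apply: (@le_trans _ _ ((\sum_i \sum_j M i j ^+ 2) * sqnorm2 x)); last first.
  by rewrite ler_wpM2r ?sqnorm2_ge0// lerDr.
rewrite mulr_suml; apply: ler_sum => i _.
have := @cauchy_schwarz_bform R n 1%:M (row i M)^T x (trmx1 _ _).
rewrite -!sqnorm2E.
have -> : bform 1%:M (row i M)^T x = (M *m x) i 0.
  by rewrite /bform mulmx1 trmxK -row_mul mxE.
have -> : sqnorm2 (row i M)^T = \sum_j M i j ^+ 2.
  by apply: eq_bigr => j _; rewrite !mxE.
by apply=> z; rewrite -sqnorm2E sqnorm2_ge0.
Qed.

(** Expanding [|B x - x|^2 >= 0] gives [2 x^T B x <= |B x|^2 + |x|^2], where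
    [|B x|^2 <= K |x|^2]. *)
Lemma bform_le_sqnorm2 (R : realType) (n : nat) (B : 'M[R]_n) :
  exists2 Q : R, 0 < Q & forall x, bform B x x <= Q * sqnorm2 x.
Proof.
have [K K0 BK] := sqnorm2_mulmx_bounded B.
exists ((K + 1) / 2) => [|x]; first by rewrite divr_gt0// addr_gt0.
have := sqnorm2_ge0 (B *m x + (-1) *: x).
have bformE : bform 1%:M x (B *m x) = bform B x x.
  by rewrite /bform mulmx1 mulmxA.
rewrite sqnorm2E !(bformDl, bformDr, bformZl, bformZr) -!sqnorm2E.
rewrite (bformC x (B *m x) (trmx1 _ _)) bformE.
have := BK x; have := sqnorm2_ge0 x; nra.
Qed.

(** * Coercivity and extreme eigenvalues of symmetric matrices *)

(** Cauchy-Schwarz for the form [B] at [x] and [B x] gives [|B x|^4 <= (x^T B x) Q |B x|^2].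
    Cancelling [|B x|^2] and using [|x|^2 <= L |B x|^2], from boundedness of the inverse, yields the
    constant [1 / (L Q)]. *)
Lemma unitmx_psd_coercive (R : realType) (n : nat) (B : 'M[R]_n) :
  B^T = B -> (forall z, 0 <= bform B z z) -> B \in unitmx ->
  exists2 c : R, 0 < c & forall x, c * sqnorm2 x <= bform B x x.
Proof.
move=> symB psdB uB.
have [L L0 BL] := sqnorm2_mulmx_bounded (invmx B).
have [Q Q0 BQ] := bform_le_sqnorm2 B.
exists (L * Q)^-1 => [|x]; first by rewrite invr_gt0 mulr_gt0.
rewrite ler_pdivrMl ?mulr_gt0//.
have := BL (B *m x); rewrite mulKmx// => xL; apply: le_trans xL _.
rewrite -mulrA ler_pM2l//.
have [->|Bx0] := eqVneq (sqnorm2 (B *m x)) 0.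
  by rewrite mulr_ge0// ltW.
have Bx_gt0 : 0 < sqnorm2 (B *m x) by rewrite lt_def Bx0 sqnorm2_ge0.
have := cauchy_schwarz_bform x (B *m x) symB psdB.
have -> : bform B x (B *m x) = sqnorm2 (B *m x).
  by rewrite sqnorm2_mul symB /bform !mulmxA.
move=> CS; rewrite -(ler_pM2r Bx_gt0) -expr2; apply: le_trans CS _.
by rewrite mulrAC mulrC ler_wpM2r.
Qed.

(* The infimum mu of the Rayleigh quotient is an eigenvalue: S - mu is positive
   semidefinite, and if it were invertible it would be coercive, so that mu
   could be increased.  This avoids compactness and the spectral theorem. *)
Lemma eigenvalue_bform_min (R : realType) (n : nat) (S : 'M[R]_n) :
  (0 < n)%N -> S^T = S ->
  exists2 mu, eigenvalue S mu & forall x, mu * sqnorm2 x <= bform S x x.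
Proof.
case: n S => // n S _ symS.
pose E := [set bform S x x | x in [set x | sqnorm2 x = 1]].
have E0 : E !=set0.
  exists (bform S (delta_mx 0 0) (delta_mx 0 0)), (delta_mx 0 0) => //=.
  exact: sqnorm2_delta.
(* An upper bound for the form of [- S] is a lower bound for that of [S]. *)
have [Q Q0 SQ] := bform_le_sqnorm2 (- S).
have lbE : has_lbound E.
  exists (- Q) => _ [x /= x1 <-]; have := SQ x; rewrite x1 mulr1 lerNl.
  by rewrite /bform mulmxN mulNmx mxE.
have muP x : inf E * sqnorm2 x <= bform S x x.
  have [->|x0] := eqVneq x 0.
    rewrite sqnorm20 mulr0.
    by rewrite /bform mulmx0 mxE.
  have nx : 0 < sqnorm2 x by rewrite lt_def sqnorm2_eq0 x0 sqnorm2_ge0.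
  have sq : Num.sqrt (sqnorm2 x) ^+ 2 = sqnorm2 x by rewrite sqr_sqrtr ?ltW.
  rewrite -ler_pdivlMr//; apply: ge_inf => //=.
  exists ((Num.sqrt (sqnorm2 x))^-1 *: x) => /=.
    by rewrite sqnorm2Z exprVn sq mulVf ?gt_eqF.
  by rewrite bformZl bformZr mulrA -expr2 exprVn sq mulrC.
exists (inf E) => //.
(* Being an eigenvalue means that [S - inf E] is singular; suppose instead that it is invertible. *)
rewrite /eigenvalue /eigenspace kermx_eq0 row_free_unit; apply/negP => uS.
have [||c c0 Sc] := unitmx_psd_coercive _ _ uS.
- by rewrite linearB /= symS tr_scalar_mx.
- by move=> z; rewrite bform_subZ subr_ge0.
suff : inf E + c <= inf E by rewrite gerDl leNgt c0.
apply: lb_le_inf => // _ [x /= x1 <-].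
by have := Sc x; rewrite bform_subZ x1 !mulr1 lerBrDl.
Qed.

Lemma eigenvalue_bform_max (R : realType) (n : nat) (S : 'M[R]_n) :
  (0 < n)%N -> S^T = S ->
  exists2 mu, eigenvalue S mu & forall x, bform S x x <= mu * sqnorm2 x.
Proof.
move=> n0 symS; have [|mu Smu muP] := eigenvalue_bform_min (S := - S) n0.
  by rewrite linearN /= symS.
exists (- mu) => [|x].
  have /eigenvalueP[v /eqP vS v0] := Smu; apply/eigenvalueP; exists v => //.
  by move: vS; rewrite mulmxN eqr_oppLR -scaleNr => /eqP.
by have := muP x; rewrite /bform mulmxN mulNmx mxE lerNr mulNr.
Qed.

(** Eigenvectors are row vectors in [eigenvalueP], hence the transposed witness. *)
Lemma eigenvalue_bform (R : realType) (n : nat) (S : 'M[R]_n) (a : R) :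
  eigenvalue S a -> exists2 x, 0 < sqnorm2 x & bform S x x = a * sqnorm2 x.
Proof.
move=> /eigenvalueP[v vS v0]; exists v^T.
  by rewrite lt_def sqnorm2_eq0 trmx_eq0 v0 sqnorm2_ge0.
by rewrite sqnorm2E /bform trmxK vS mulmx1 -scalemxAl mxE.
Qed.

(** * Variational bounds for the extreme singular values *)

Lemma trmx_gram (R : realType) (m p : nat) (M : 'M[R]_(m, p)) :
  (M^T *m M)^T = M^T *m M.
Proof. by rewrite trmx_mul trmxK. Qed.

Lemma singular_valuesP (R : realType) (m p : nat) (M : 'M[R]_(m, p)) (s : R) :
  (p <= m)%N ->
  singular_values M s <-> 0 <= s /\ eigenvalue (M^T *m M) (s ^+ 2).
Proof. by move=> pm; rewrite /singular_values /= pm. Qed.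

(** The eigenvalue [mu] of the Gram matrix that bounds its Rayleigh quotient from below is
    nonnegative, and [Num.sqrt mu] is a singular value below all others. So the [inf] is an attained
    minimum. *)
Lemma min_singular_value_attained (R : realType) (m p : nat) (M : 'M[R]_(m, p)) :
  (0 < p)%N -> (p <= m)%N -> singular_values M (min_singular_value M) /\
  forall x, min_singular_value M ^+ 2 * sqnorm2 x <= sqnorm2 (M *m x).
Proof.
move=> p0 pm; have [mu Mmu muP] := eigenvalue_bform_min p0 (trmx_gram M).
have mu0 : 0 <= mu.
  have [x x0 xE] := eigenvalue_bform Mmu.
  by rewrite -(pmulr_lge0 _ x0) -xE -sqnorm2_mul sqnorm2_ge0.
have sv : singular_values M (Num.sqrt mu).
  by apply/singular_valuesP => //; rewrite sqrtr_ge0 sqr_sqrtr.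
suff -> : min_singular_value M = Num.sqrt mu.
  by split=> // x; rewrite sqr_sqrtr// sqnorm2_mul.
apply/eqP; rewrite eq_le; apply/andP; split.
  by apply: ge_inf => //; exists 0 => s /(singular_valuesP _ _ pm)[].
apply: lb_le_inf; first by exists (Num.sqrt mu).
move=> s /(singular_valuesP _ _ pm)[s0 /eigenvalue_bform[x x0 xE]].
rewrite -(@ler_sqr _ (Num.sqrt mu)) ?nnegrE ?sqrtr_ge0// sqr_sqrtr//.
by rewrite -(ler_pM2r x0) -xE.
Qed.

Lemma max_singular_value_attained (R : realType) (m p : nat) (M : 'M[R]_(m, p)) :
  (0 < p)%N -> (p <= m)%N -> singular_values M (max_singular_value M) /\
  forall x, sqnorm2 (M *m x) <= max_singular_value M ^+ 2 * sqnorm2 x.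
Proof.
move=> p0 pm; have [mu Mmu muP] := eigenvalue_bform_max p0 (trmx_gram M).
have mu0 : 0 <= mu.
  have [x x0 xE] := eigenvalue_bform Mmu.
  by rewrite -(pmulr_lge0 _ x0) -xE -sqnorm2_mul sqnorm2_ge0.
have sv : singular_values M (Num.sqrt mu).
  by apply/singular_valuesP => //; rewrite sqrtr_ge0 sqr_sqrtr.
(* Used in both inequalities: it bounds the supremum, and it makes the set bounded, so that [sup]
   dominates its elements. *)
have ub : ubound (singular_values M) (Num.sqrt mu).
  move=> s /(singular_valuesP _ _ pm)[s0 /eigenvalue_bform[x x0 xE]].
  rewrite -(@ler_sqr _ s) ?nnegrE ?sqrtr_ge0// sqr_sqrtr//.
  by rewrite -(ler_pM2r x0) -xE.
suff -> : max_singular_value M = Num.sqrt mu.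
  by split=> // x; rewrite sqr_sqrtr// sqnorm2_mul.
apply/eqP; rewrite eq_le; apply/andP; split.
  by apply: ge_sup => //; exists (Num.sqrt mu).
by apply: ub_le_sup => //; exists (Num.sqrt mu).
Qed.

(** * The penalty matrix and growth of its condition number *)

Lemma penalty_mx_col_mx (R : realType) (n : nat) (A : 'M[R]_n) (y : 'cV[R]_n)
    (lambda : R) (u : 'cV[R]_n) (theta : R) :
  penalty_mx A y lambda *m col_mx u theta%:M =
  col_mx u (Num.sqrt lambda *: (A *m u - theta *: y)).
Proof.
rewrite /penalty_mx mul_block_col mul1mx mul0mx addr0; congr col_mx.
by rewrite mulNmx -!scalemxAl mul_mx_scalar scalerBr.
Qed.

Lemma penalty_lossE (R : realType) (n : nat) (A : 'M[R]_n) (y : 'cV[R]_n)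
    (lambda : R) (u : 'cV[R]_n) (theta : R) : 0 <= lambda ->
  penalty_loss A y lambda u theta =
  lsq_loss (penalty_problem A y lambda) (col_mx u theta%:M).
Proof.
move=> l0; rewrite /lsq_loss /= penalty_mx_col_mx opp_col_mx add_col_mx oppr0.
by rewrite addr0 sqnorm2_col_mx sqnorm2Z sqr_sqrtr.
Qed.

(** A zero singular value would give the invertible Gram matrix a nonzero kernel vector. Finiteness
    turns [condition_number A ^+ 2] into a real threshold. *)
Lemma condition_number_fin (R : realType) (n : nat) (A : 'M[R]_n) :
  (0 < n)%N -> A \in unitmx -> exists k : R, condition_number A = k%:E.
Proof.
move=> n0 uA; rewrite /condition_number; case: eqP => [A0|_]; last first.
  by eexists.
have [/(singular_valuesP _ _ (leqnn n))[_]] :=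
  min_singular_value_attained A n0 (leqnn n).
rewrite A0 expr0n => /eigenvalueP[v + v0] _; rewrite scale0r.
have uAA : A^T *m A \in unitmx by rewrite unitmx_mul unitmx_tr uA.
move=> /(congr1 (mulmxr (invmx (A^T *m A)))) /=.
by rewrite mulmxK// mul0mx => /eqP; rewrite (negPf v0).
Qed.

Lemma penalty_condition_number_ge (R : realType) (n : nat) (A : 'M[R]_n)
    (y : 'cV[R]_n) : (0 < n)%N -> A \in unitmx ->
  exists2 c : R, 0 < c & forall lambda, 0 <= lambda ->
    ((Num.sqrt lambda * c)%:E <= condition_number (penalty_mx A y lambda))%E.
Proof.
case: n A y => // n A y _ uA.
pose e : 'cV[R]_n.+1 := delta_mx 0 0.
have e1 : sqnorm2 e = 1 by exact: sqnorm2_delta.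
have Ae0 : 0 < sqnorm2 (A *m e).
  rewrite lt_def sqnorm2_ge0 andbT sqnorm2_eq0; apply/eqP => Ae.
  move: e1; rewrite -(mulKmx uA e) Ae mulmx0 => /eqP.
  by rewrite sqnorm20 eq_sym oner_eq0.
exists (Num.sqrt (sqnorm2 (A *m e))) => [|lambda l0]; first by rewrite sqrtr_gt0.
set M := penalty_mx A y lambda.
have p0 : (0 < n.+1 + 1)%N by rewrite addn1.
(* This selects the Gram matrix [M^T *m M] in [singular_values]; it rests on the dimension of [A]
   being at least 1. *)
have pm : (n.+1 + 1 <= n.+1 + n.+1)%N by rewrite leq_add2l.
have [/(singular_valuesP _ _ pm)[smin0 _] sminP] :=
  min_singular_value_attained M p0 pm.
have [/(singular_valuesP _ _ pm)[smax0 _] smaxP] :=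
  max_singular_value_attained M p0 pm.
rewrite /condition_number; case: eqP => [//|/eqP smin_neq0]; first by rewrite leey.
have smin_gt0 : 0 < min_singular_value M by rewrite lt_def smin_neq0.
rewrite lee_fin ler_pdivlMr//.
have smin1 : min_singular_value M <= 1.
  (* The residual block vanishes here, so the Rayleigh quotient is
     [|A^-1 y|^2 / (|A^-1 y|^2 + 1)]. *)
  have := sminP (col_mx (invmx A *m y) 1%:M).
  rewrite penalty_mx_col_mx mulKVmx// scale1r subrr scaler0 !sqnorm2_col_mx.
  rewrite sqnorm20 addr0.
  have -> : sqnorm2 (1%:M : 'cV[R]_1) = 1.
    by rewrite /sqnorm2 big_ord1 mxE expr1n.
  rewrite -(@ler_sqr _ _ 1) ?nnegrE// expr1n.
  have := sqnorm2_ge0 (invmx A *m y); nra.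
apply: (@le_trans _ _ (Num.sqrt lambda * Num.sqrt (sqnorm2 (A *m e)))).
  by rewrite ler_piMr// mulr_ge0 ?sqrtr_ge0.
rewrite -sqrtrM// -(@ler_sqr _ (Num.sqrt _)) ?nnegrE ?sqrtr_ge0//.
rewrite sqr_sqrtr ?mulr_ge0 ?sqnorm2_ge0//.
(* The image has squared norm [1 + lambda |A e|^2]; the 1 is dropped. *)
have := smaxP (col_mx e 0%:M).
rewrite penalty_mx_col_mx scale0r subr0 !sqnorm2_col_mx sqnorm2Z sqr_sqrtr//.
rewrite e1 raddf0 sqnorm20; lra.
Qed.

Lemma penalty_condition_number_near_ge (R : realType) (n : nat) (A : 'M[R]_n)
    (y : 'cV[R]_n) (K : R) : (0 < n)%N -> A \in unitmx ->
  \forall lambda \near pinfty_nbhs R,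
    (K%:E <= condition_number (penalty_mx A y lambda))%E.
Proof.
move=> n0 uA; have [c c0 cP] := penalty_condition_number_ge y n0 uA.
(* Solves [Num.sqrt lambda * c >= K] for [lambda]; since [K] may be negative, the comparison passes
   through [|K / c|]. *)
exists ((K / c) ^+ 2); split; first exact: num_real.
move=> lambda /ltW Kl; have l0 := le_trans (sqr_ge0 _) Kl.
apply: le_trans (cP _ l0); rewrite lee_fin -ler_pdivrMr//.
by rewrite (le_trans (ler_norm _))// -sqrtr_sqr ler_wsqrtr.
Qed.

Theorem theorem2p2 (R : realType) (n : nat) (hn : (0 < n)%N)
    (A : 'M[R]_n) (hA : A \in unitmx) (y : 'cV[R]_n) :
  (condition_number A ^+ 2 <=
     limf_einf (fun lambda : R => condition_number (penalty_mx A y lambda))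
       (pinfty_nbhs R))%E
  /\
  ((forall (lambda : R) (u : 'cV[R]_n) (theta : R), 0 < lambda ->
      penalty_loss A y lambda u theta =
      lsq_loss (penalty_problem A y lambda) (col_mx u theta%:M))
   /\
   (forall eps : R, 0 < eps ->
      \forall lambda \near pinfty_nbhs R,
        ((1 - eps)%:E * pcl_condition_number A ^+ 2 <=
           lsq_condition_number (penalty_problem A y lambda))%E)).
Proof.
have [k Ak] := condition_number_fin hn hA.
(* Since [K] is arbitrary, both asymptotic claims follow, with [K = k ^+ 2] and
   [K = (1 - eps) * k ^+ 2]. *)
have near_ge K := penalty_condition_number_near_ge y K hn hA.
split; last split=> [lambda u theta /ltW|eps _]; last 2 first.
- exact: penalty_lossE.
- by rewrite /pcl_condition_number Ak -EFin_expe -EFinM; exact: near_ge.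
(* The lower limit is now a supremum, over sets of the filter, of infima. One set suffices: the one
   where the condition number is at least [k ^+ 2]. *)
rewrite Ak -EFin_expe limf_einfE.
apply: le_trans (ereal_sup_ubound _); last first.
  by exists [set lambda | (k ^+ 2)%:E <= condition_number (penalty_mx A y lambda)]%E;
    [exact: near_ge|].
by apply: le_ereal_inf_tmp => _ [lambda /= + <-].
Qed.
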